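(* There is a dilatory $\varphi$-function $G$ such that the Orlicz--Lorentz space $L_{1,G}$ is not a quasi-Banach space.
   Context: A $\varphi$-function is a continuous, strictly increasing function $F:[0,\infty)\to[0,\infty)$ with $F(0)=0$ and $\lim_{t\to\infty}F(t)=\infty$. It is dilatory if there are $1<c_1,c_2<\infty$ with $F(c_1t)\ge c_2F(t)$ for all $t\ge0$. For a $\varphi$-function $F$ put $\tilde F(t)=1/F(1/t)$ for $t>0$ and $\tilde F(0)=0$. Functions live on $[0,\infty)$ with Lebesgue measure $\lambda$; $f^*(x)=\sup\{t:\lambda(|f|\ge t)\ge x\}$. Luxemburg functional: $\|f\|_G=\inf\{c>0:\int_0^\infty G(|f(x)|/c)\,dx\le1\}$. The space $L_{1,G}$ consists of measurable $f$ (modulo a.e. equality) with $\|f\|_{1,G}=\|f^*\circ\tilde G^{-1}\|_G<\infty$, equipped with the functional $\|\cdot\|_{1,G}$. *)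

(* Defs.v *)
From HB Require Import structures.
From mathcomp Require Import all_boot all_order all_algebra.
From mathcomp Require Import all_classical all_reals all_analysis.
Set Implicit Arguments. Unset Strict Implicit. Unset Printing Implicit Defensive.
Import Order.TTheory GRing.Theory Num.Theory.
Import numFieldNormedType.Exports.
Local Open Scope classical_set_scope.
Local Open Scope ring_scope.

Section OrliczLorentz.
Variable R : realType.
Local Notation mu := (@lebesgue_measure R).

Definition nonneg : set R := [set x : R | 0 <= x].

Definition phi_function (F : R -> R) : Prop :=
  [/\ {within `[0, +oo[, continuous F},
      (forall x y, 0 <= x -> x < y -> F x < F y),
      F 0 = 0 &
      F x @[x --> +oo] --> +oo].

Definition dilatory (F : R -> R) : Prop :=
  exists c1 c2 : R, [/\ 1 < c1, 1 < c2 &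
    forall t, 0 <= t -> c2 * F t <= F (c1 * t)].

Definition phi_tilde (F : R -> R) (t : R) : R :=
  if 0 < t then (F t^-1)^-1 else 0.

Definition phi_inv (F : R -> R) (y : R) : R :=
  sup [set t : R | 0 <= t /\ F t <= y].

Definition level_set (f : R -> R) (t : R) : set R :=
  nonneg `&` (fun y => t <= `|f y|).

Definition rearr (f : R -> R) (x : R) : \bar R :=
  ereal_sup [set t%:E | t in [set t : R | 0 <= t /\
     (x%:E <= mu (level_set f t))%E]].

Definition ext_phi (G : R -> R) (e : \bar R) : \bar R :=
  match e with
  | r%:E => (G r)%:E
  | +oo%E => +oo%E
  | -oo%E => 0%E
  end.

Definition luxemburg (G : R -> R) (h : R -> \bar R) : \bar R :=
  ereal_inf [set c%:E | c in [set c : R | 0 < c /\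
     (\int[mu]_(x in nonneg) ext_phi G (h x * (c^-1)%:E) <= 1)%E]].

Definition norm1G (G : R -> R) (f : R -> R) : \bar R :=
  luxemburg G (fun x => rearr f (phi_inv (phi_tilde G) x)).

(* the space L_{1,G} (representatives; the functional is a.e.-invariant) *)
Definition L1G (G : R -> R) : set (R -> R) :=
  [set f | measurable_fun nonneg f /\ (norm1G G f < +oo)%E].

Definition quasi_Banach_L1G (G : R -> R) : Prop :=
  [/\ ((forall f g, L1G G f -> L1G G g -> L1G G (fun x => f x + g x)%R) /\
       (forall (a : R) f, L1G G f -> L1G G (fun x => a * f x))),
      (forall f, L1G G f ->
         (norm1G G f = 0%E <->
          mu.-negligible (nonneg `&` [set x | f x != 0]))),
      (forall (a : R) f, L1G G f ->
         norm1G G (fun x => a * f x) = (`|a|%:E * norm1G G f)%E),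
      (exists C : R, 1 <= C /\ forall f g, L1G G f -> L1G G g ->
         (norm1G G (fun x => f x + g x)%R <= C%:E * (norm1G G f + norm1G G g))%E) &
      (forall u : nat -> R -> R, (forall n, L1G G (u n)) ->
         (forall eps : R, 0 < eps -> exists N, forall m n, (N <= m)%N -> (N <= n)%N ->
            (norm1G G (fun x => u n x - u m x)%R <= eps%:E)%E) ->
         exists2 f, L1G G f &
           forall eps : R, 0 < eps -> exists N, forall n, (N <= n)%N ->
            (norm1G G (fun x => u n x - f x)%R <= eps%:E)%E)].

End OrliczLorentz.

(* Main.v *)
(** Let [q] increase from [0] to infinity.  Rounding [(2 * x)^-1] down to a
    term of [q] gives a function [f] that is nonincreasing on the positive
    reals, and the inverse of [phi_tilde G] maps [1 / G s] to [1 / s], so the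
    modular of [f] is at most the sum of the [G (q j) / G (2 * q j)].  Adding
    to [f] its translate by [1] doubles the level sets: the rearrangement of
    the sum is at least [q j] at [1 / q j], and the modular of the sum divided
    by [c] is at least a tail of the series of general term
    [G (q j / c) * (1 / G (q j) - 1 / G (q j.+1))].

    Hence [L_{1,G}] is not even closed under addition when [G] jumps right
    after each [q j], which makes the first sum at most [1], and yet is
    comparable to a linear function on ever longer intervals ending at [q j],
    which makes the second one diverge for every [c].  The convex function
    [G t = sup_j s j * (t - q j)] has both properties if [s j.+1 / s j] and
    [q j.+1 / q j] tend to infinity, the first one fast enough. *)
Require Import Defs.
From mathcomp Require Import all_boot all_order all_algebra.
From mathcomp Require Import all_classical all_reals all_analysis.
From mathcomp Require Import measurable_realfun ring lra zify.
Set Implicit Arguments.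
Unset Strict Implicit.
Unset Printing Implicit Defensive.
Import Order.TTheory GRing.Theory Num.Theory.
Import numFieldNormedType.Exports.
Local Open Scope classical_set_scope.
Local Open Scope ring_scope.

Section PhiFunctions.
Variables (R : realType) (F : R -> R).
Hypothesis F_phi : phi_function F.
Implicit Types (s t u x y : R) (e : \bar R).

Lemma phi_function0 : F 0 = 0.
Proof. by case: F_phi. Qed.

Lemma phi_function_le x y : 0 <= x -> 0 <= y -> (F x <= F y) = (x <= y).
Proof.
have [_ F_incr _ _] := F_phi; move=> x0 y0.
have [xy|yx|->] := ltgtP x y; last by rewrite lexx.
- by rewrite ltW// F_incr.
- by apply/negbTE; rewrite -ltNge F_incr.
Qed.

Lemma phi_function_ge0 x : 0 <= x -> 0 <= F x.
Proof. by move=> x0; rewrite -phi_function0 phi_function_le. Qed.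

Lemma phi_function_gt0 x : 0 < x -> 0 < F x.
Proof. by have [_ F_incr F0 _] := F_phi => x0; rewrite -F0 F_incr. Qed.

Lemma phi_function_surj y : 0 < y -> exists2 s, 0 < s & F s = y.
Proof.
have [F_cont _ _ /cvgryPge/(_ y) F_infty] := F_phi => y0.
have [t [t0 yt]] : exists t, 0 <= t /\ y <= F t.
  near (+oo : set_system R) => t; exists t; split; near: t => //.
  by apply: nbhs_pinfty_ge; exact: num_real.
have [s] : exists2 s, s \in `[0, t] & F s = y.
  apply: IVT => //; last first.
    by rewrite phi_function0 ge_min le_max ltW//= yt orbT.
  apply: continuous_subspaceW F_cont => s/=.
  by rewrite !in_itv/= => /andP[->].
rewrite in_itv/= => /andP[s0 _] Fs; exists s => //.
rewrite lt_def s0 andbT; apply: contraTneq y0 => s_eq0.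
by rewrite -Fs s_eq0 phi_function0 ltxx.
Unshelve. all: by end_near. Qed.

Lemma phi_tilde_leV u t : 0 < u -> (phi_tilde F t <= (F u)^-1) = (t <= u^-1).
Proof.
move=> u0; rewrite /phi_tilde; have [t0|t0] := ltP 0 t.
  rewrite lef_pV2 ?posrE ?phi_function_gt0 ?invr_gt0//.
  rewrite phi_function_le ?invr_ge0 ?(ltW u0) ?(ltW t0)//.
  by rewrite invf_pge.
by rewrite !(le_trans t0) ?invr_ge0 ?phi_function_ge0 ?(ltW u0).
Qed.

Lemma phi_inv_tilde u : 0 < u -> phi_inv (phi_tilde F) (F u)^-1 = u^-1.
Proof.
move=> u0; have /sup_itvcc <- : 0 <= u^-1 by rewrite invr_ge0 ltW.
congr sup; apply/seteqP.
by split=> t /=; rewrite in_itv/= phi_tilde_leV// => /andP.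
Qed.

Lemma phi_inv_tilde_le u x : 0 < u -> 0 <= x -> x <= (F u)^-1 ->
  phi_inv (phi_tilde F) x <= u^-1.
Proof.
move=> u0 x0 xu; apply: ge_sup.
  by exists 0; split=> //; rewrite /phi_tilde ltxx.
by move=> t [_ tx]; rewrite -phi_tilde_leV// (le_trans tx).
Qed.

Lemma ext_phi_le e1 e2 : (0 <= e1)%E -> (e1 <= e2)%E ->
  (ext_phi F e1 <= ext_phi F e2)%E.
Proof.
case: e1 e2 => [x| |] [y| |]//=; rewrite ?lee_fin ?leey// => x0 xy.
by rewrite phi_function_le// (le_trans x0).
Qed.

Lemma ext_phi_ge0 e : (0 <= e)%E -> (0 <= ext_phi F e)%E.
Proof. by case: e => [x| |]//=; rewrite !lee_fin; exact: phi_function_ge0. Qed.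

End PhiFunctions.

Lemma nneseries_ge_term (R : realType) (u : nat -> \bar R) (k : nat) :
  (forall j, 0 <= u j)%E -> (u k <= \sum_(0 <= j <oo) u j)%E.
Proof.
move=> u0; apply: le_trans (nneseries_lim_ge k.+1 _) => //.
by rewrite big_nat_recr//= leeDr// sume_ge0.
Qed.

Section IntegralBounds.
Local Open Scope ereal_scope.
Context d (T : measurableType d) (R : realType).
Variables (mu : {measure set T -> \bar R}) (D : set T).
Implicit Types (f g h : T -> \bar R) (a : nat -> R) (A : nat -> set T).

Lemma ge0_le_integral_nomeas f g :
  (forall x, D x -> 0 <= f x) -> (forall x, D x -> f x <= g x) ->
  \int[mu]_(x in D) f x <= \int[mu]_(x in D) g x.
Proof.
move=> f0 fg; rewrite !ge0_integralE//; last first.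
  by move=> x Dx; exact: le_trans (f0 _ Dx) (fg _ Dx).
apply: ereal_sup_le => _ [k kf <-]; exists k => // x.
by apply: le_trans (kf x) _; exact: lee_restrict.
Qed.

Hypothesis mD : measurable D.

Let measurable_cst_indic (r : R) (B : set T) : measurable B ->
  measurable_fun D (fun x => r%:E * (\1_B x)%:E).
Proof.
move=> mB; apply: emeasurable_funM => //.
exact/measurable_EFinP/measurable_indic.
Qed.

Let integral_cst_indic (r : R) (B : set T) : (0 <= r)%R -> measurable B ->
  B `<=` D -> \int[mu]_(x in D) (r%:E * (\1_B x)%:E) = r%:E * mu B.
Proof.
move=> r0 mB BD; rewrite ge0_integralZl_EFin ?integral_indic ?setIidl//.
exact/measurable_EFinP/measurable_indic.
Qed.

Lemma integral_le_nneseries a A h : (forall j, 0 <= a j)%R ->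
  (forall j, measurable (A j)) -> (forall j, A j `<=` D) ->
  (forall x, D x -> 0 <= h x) ->
  (forall x, D x -> h x <= \sum_(0 <= j <oo) (a j)%:E * (\1_(A j) x)%:E) ->
  \int[mu]_(x in D) h x <= \sum_(0 <= j <oo) (a j)%:E * mu (A j).
Proof.
move=> a0 mA AD h0 hle; apply: le_trans (ge0_le_integral_nomeas h0 hle) _.
rewrite integral_nneseries//.
- by apply: lee_nneseries => [j _ _|j _];
    rewrite integral_cst_indic ?mule_ge0 ?lee_fin.
- by move=> j; exact: measurable_cst_indic.
- by move=> j x _; rewrite mule_ge0// lee_fin.
Qed.

Lemma sum_le_integral a A h n : (forall j, 0 <= a j)%R ->
  (forall j, measurable (A j)) -> (forall j, A j `<=` D) ->
  trivIset setT A -> (forall x, D x -> 0 <= h x) ->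
  (forall j x, A j x -> (a j)%:E <= h x) ->
  \sum_(j < n) (a j)%:E * mu (A j) <= \int[mu]_(x in D) h x.
Proof.
move=> a0 mA AD tA h0 ah.
rewrite [leLHS](_ : _ = \int[mu]_(x in D)
    \sum_(j < n) ((a j)%:E * (\1_(A j) x)%:E)); last first.
  rewrite ge0_integral_sum//.
  - by apply: eq_bigr => j _; rewrite integral_cst_indic.
  - by move=> j; exact: measurable_cst_indic.
  - by move=> j x _; rewrite mule_ge0// lee_fin.
apply: ge0_le_integral_nomeas => x Dx.
  by apply: sume_ge0 => j _; rewrite mule_ge0// lee_fin.
have [[k Akx]|noA] := pselect (exists k : 'I_n, A k x); last first.
  rewrite big1 ?h0// => j _; rewrite indicE memNset ?mule0// => Ajx.
  by apply: noA; exists j.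
rewrite (bigD1 k)//= big1 => [|j jk].
  by rewrite adde0 indicE mem_set// mule1 ah.
rewrite indicE memNset ?mule0// => Ajx; move/eqP: jk; apply; apply/val_inj.
by apply: tA => //; exists x.
Qed.

End IntegralBounds.

Section Rearrangement.
Variable R : realType.
Local Notation mu := (@lebesgue_measure R).
Implicit Types (f : R -> R) (A : set R) (r t y : R).

Lemma nonnegE : @nonneg R = `[0, +oo[%classic.
Proof. by apply/seteqP; split=> x /=; rewrite /nonneg/= in_itv/= andbT. Qed.

Lemma measurable_nonneg : measurable (@nonneg R).
Proof. by rewrite nonnegE. Qed.

Lemma measurable_level_set f t :
  measurable_fun (@nonneg R) f -> measurable (level_set f t).
Proof.
move=> mf; have mh : measurable_fun (@nonneg R) (fun x => `|f x|).
  exact: measurableT_comp.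
have := mh measurable_nonneg `[t, +oo[%classic (measurable_itv _).
congr measurable; rewrite /level_set; congr (_ `&` _).
by apply/seteqP; split=> x /=; rewrite in_itv/= andbT.
Qed.

Lemma rearr_ge0 f y : (0 <= rearr f y)%E.
Proof.
apply: ereal_sup_ubound => /=; exists 0 => //; split=> //.
have -> : level_set f 0 = `[0, +oo[%classic.
  by rewrite -nonnegE; apply/setIidPl => x _; exact: normr_ge0.
by rewrite lebesgue_measure_itv/= ltry leey.
Qed.

Lemma rearr_le f A r y : measurable_fun (@nonneg R) f -> measurable A ->
  (mu A < y%:E)%E -> (forall t, r < t -> level_set f t `<=` A) ->
  (rearr f y <= r%:E)%E.
Proof.
move=> mf mA Ay fA; apply: ge_ereal_sup => _ [t [t0 yt] <-].
rewrite lee_fin leNgt; apply/negP => rt.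
suff /le_lt_trans/(_ Ay) : (y%:E <= mu A)%E by rewrite ltxx.
apply: le_trans yt _.
by apply: le_measure; rewrite ?inE; [exact: measurable_level_set| |exact: fA].
Qed.

Lemma rearr_ge f A t y : measurable_fun (@nonneg R) f -> measurable A ->
  (y%:E <= mu A)%E -> 0 <= t -> A `<=` level_set f t ->
  (t%:E <= rearr f y)%E.
Proof.
move=> mf mA yA t0 Af; apply: ereal_sup_ubound; exists t => //; split=> //.
apply: le_trans yA _.
by apply: le_measure; rewrite ?inE; [|exact: measurable_level_set|].
Qed.

Lemma lebesgue_measure_itvoc (a b : R) : a <= b ->
  mu `]a, b]%classic = (b - a)%:E.
Proof.
rewrite lebesgue_measure_itv/= lte_fin le_eqVlt => /predU1P[->|->//].
by rewrite ltxx subrr.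
Qed.

Lemma trivIset_itvoc (b : nat -> R) : (forall j, b j.+1 <= b j) ->
  trivIset setT (fun j => `]b j.+1, b j]%classic).
Proof.
move=> /nonincreasing_seqP b_ni.
have disj i j x : (i < j)%N -> b i.+1 < x -> x <= b j -> False.
  by move=> /b_ni ji xi /le_trans/(_ ji); rewrite leNgt xi.
move=> i j _ _ [x [/=]]; rewrite !in_itv/= => /andP[ix xi] /andP[jx xj].
by have [/disj/(_ ix xj)|/disj/(_ jx xi)|] := ltngtP i j.
Qed.

End Rearrangement.

Section Modular.
Variables (R : realType) (G : R -> R).
Implicit Types (f : R -> R) (c : R).

Definition modular1G f c : \bar R :=
  (\int[@lebesgue_measure R]_(x in @nonneg R)
     ext_phi G (rearr f (phi_inv (phi_tilde G) x) * c^-1%:E))%E.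

Lemma norm1G_le f c : 0 < c -> (modular1G f c <= 1)%E ->
  (norm1G G f <= c%:E)%E.
Proof. by move=> c0 fc; apply: ereal_inf_lbound; exists c. Qed.

Lemma norm1G_infty f : (forall c, 0 < c -> (1 < modular1G f c)%E) ->
  norm1G G f = +oo%E.
Proof.
move=> f_gt1; apply/ereal_inf_pinfty => _ [c [c0 fc] <-].
by have := lt_le_trans (f_gt1 c c0) fc; rewrite ltxx.
Qed.

End Modular.

Section NonincreasingOnPositives.
Variables (R : realType) (f : R -> R).
Hypothesis f_ge0 : forall x, 0 <= f x.
Hypothesis f_le0 : forall x, x <= 0 -> f x = 0.
Hypothesis f_ni : forall x y, 0 < x -> x <= y -> f y <= f x.
Local Notation mu := (@lebesgue_measure R).
Implicit Types a b x y z : R.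

Lemma measurable_nonincreasing_on_pos : measurable_fun setT f.
Proof.
apply: (measurability _ (RGenCInfty.measurableE R)) => // _ [_ [r ->] <-].
rewrite setTI; apply: is_interval_measurable => x z /=.
rewrite !in_itv/= !andbT => rx rz y /andP[xy yz]; rewrite in_itv/= andbT.
have [y0|y0] := ltP 0 y; first exact: le_trans rz (f_ni y0 yz).
by rewrite f_le0// -(f_le0 (le_trans xy y0)).
Qed.

Lemma measurable_nonincreasing_on_pos_shift a :
  measurable_fun (@nonneg R) (fun x => f (x - a)).
Proof.
apply: measurable_funTS; apply: measurableT_comp.
  exact: measurable_nonincreasing_on_pos.
exact: measurable_funB.
Qed.

Lemma rearr_shift_le a z y : 0 < z -> z < y ->
  (rearr (fun x => f (x - a)) y <= (f z)%:E)%E.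
Proof.
move=> z0 zy; apply: (@rearr_le _ _ `]a, (z + a)]%classic) => //.
- exact: measurable_nonincreasing_on_pos_shift.
- by rewrite lebesgue_measure_itvoc ?lerDr ?(ltW z0)// addrK lte_fin.
move=> t fzt x [_]; rewrite /= ger0_norm// in_itv/= -subr_gt0 -lerBlDr => tf.
have fz : f z < f (x - a) by exact: lt_le_trans tf.
apply/andP; split; last first.
  by rewrite leNgt; apply: contraTN fz => /ltW zx; rewrite -leNgt f_ni.
by rewrite ltNge; apply: contraTN fz => /f_le0 ->; rewrite -leNgt.
Qed.

Lemma rearr_add_shift_ge a b y : 0 < b -> b <= a -> y <= 2 * b ->
  ((f b)%:E <= rearr (fun x => f x + f (x - a))%R y)%E.
Proof.
move=> b0 ba yb; pose A : set R := `]0, (b + 0)] `|` `]a, (b + a)].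
apply: (@rearr_ge _ _ A) => //.
- apply: measurable_funD; last exact: measurable_nonincreasing_on_pos_shift.
  by apply: measurable_funTS; exact: measurable_nonincreasing_on_pos.
- exact: measurableU.
- rewrite measureU//=; last first.
    by apply/seteqP; split=> // x [] /=; rewrite !in_itv/=; lra.
  rewrite !lebesgue_measure_itvoc ?lerDr ?(ltW b0)// !addrK -EFinD lee_fin.
  by lra.
move=> x Ax; have x0 : 0 < x by case: Ax => /=; rewrite in_itv/=; lra.
split; first exact: ltW.
rewrite ger0_norm ?addr_ge0//; case: Ax => /=; rewrite in_itv/= => xA.
  by rewrite -[f b]addr0 lerD// f_ni//; lra.
by rewrite -[f b]add0r lerD// f_ni//; lra.
Qed.

End NonincreasingOnPositives.

Section SequenceFloor.
Variables (R : realType) (q : nat -> R).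
Hypothesis q0 : q 0%N = 0.
Hypothesis q_nd : {homo q : i j / (i <= j)%N >-> i <= j}.
Hypothesis q_infty : q j @[j --> \oo] --> +oo.
Implicit Types (k : nat) (x y : R).

Lemma nondecreasing_seq_ge0 k : 0 <= q k.
Proof. by rewrite -q0 q_nd. Qed.

Lemma seq_bracket y : 0 <= y -> exists k, q k <= y < q k.+1.
Proof.
move=> y0; have /ex_minnP[k yk kmin] : exists k, y < q k.
  have [N _ yN] := (cvgryPgt _).1 q_infty y.
  by exists N; apply: yN => /=.
case: k => [|k] in yk kmin *; first by rewrite q0 ltNge y0 in yk.
exists k; rewrite yk andbT leNgt; apply: contraTN (ltnSn k) => /kmin.
by rewrite -leqNgt.
Qed.

Definition seq_floor y : R := sup [set q j | j in [set j | q j <= y]].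

Lemma seq_floor_lt0 y : y < 0 -> seq_floor y = 0.
Proof.
move=> y0; rewrite /seq_floor (_ : [set _ | _ in _] = set0) ?sup0//.
apply/seteqP; split=> // _ [j /= jy _].
have := le_lt_trans (nondecreasing_seq_ge0 j) (le_lt_trans jy y0).
by rewrite ltxx.
Qed.

Lemma seq_floor_ge k y : q k <= y -> q k <= seq_floor y.
Proof. by move=> ky; apply: ub_le_sup; [exists y => _ [j jy <-]|exists k]. Qed.

Lemma seq_floorE k y : q k <= y < q k.+1 -> seq_floor y = q k.
Proof.
move=> /andP[ky yk]; apply/le_anti; rewrite seq_floor_ge// andbT.
apply: ge_sup; first by exists (q k), k.
move=> _ [j /= jy <-]; rewrite q_nd// leqNgt; apply: contraTN yk => kj.
by rewrite -leNgt (le_trans (q_nd kj)).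
Qed.

Lemma seq_floor_ge0 y : 0 <= seq_floor y.
Proof.
have [/seq_floor_lt0->//|/seq_bracket[k /seq_floorE->]] := ltP y 0.
exact: nondecreasing_seq_ge0.
Qed.

Lemma seq_floor_le0 y : y <= 0 -> seq_floor y = 0.
Proof.
rewrite le_eqVlt => /predU1P[->|/seq_floor_lt0//].
have [k kP] := seq_bracket (lexx 0); rewrite (seq_floorE kP); apply/le_anti.
by rewrite nondecreasing_seq_ge0 andbT; case/andP: kP.
Qed.

Lemma seq_floor_nd : {homo seq_floor : x y / x <= y}.
Proof.
move=> x y xy; have [x0|/seq_bracket[k kP]] := ltP x 0.
  by rewrite seq_floor_lt0// seq_floor_ge0.
by rewrite (seq_floorE kP) seq_floor_ge//; case/andP: kP => /le_trans->.
Qed.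

End SequenceFloor.

Section AdditivityCriterion.
Variables (R : realType) (G : R -> R) (q : nat -> R).
Hypothesis G_phi : phi_function G.
Hypothesis q0 : q 0%N = 0.
Hypothesis q_nd : {homo q : i j / (i <= j)%N >-> i <= j}.
Hypothesis q_infty : q j @[j --> \oo] --> +oo.
Local Notation mu := (@lebesgue_measure R).
Implicit Types (j k : nat) (a c x y : R).

Definition knot_step x : R := seq_floor q (2 * x)^-1.

Local Notation f := knot_step.

Lemma knot_step_ge0 x : 0 <= f x.
Proof. exact: seq_floor_ge0. Qed.

Lemma knot_step_le0 x : x <= 0 -> f x = 0.
Proof. by move=> x0; rewrite /f seq_floor_le0// invr_le0 pmulr_rle0. Qed.

Lemma knot_step_ni x y : 0 < x -> x <= y -> f y <= f x.
Proof.
move=> x0 xy; have y0 : 0 < y by exact: lt_le_trans xy.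
by apply: seq_floor_nd => //; rewrite lef_pV2 ?posrE ?mulr_gt0// ler_pM2l.
Qed.

Lemma knot_step_near_left k y : 0 < y -> q k <= (2 * y)^-1 < q k.+1 ->
  exists z, [/\ 0 < z, z < y & f z = q k].
Proof.
move=> y0 /andP[ky yk]; have k0 : 0 < q k.+1.
  by apply: lt_trans yk; rewrite invr_gt0 mulr_gt0.
have qV0 : 0 < (q k.+1)^-1 by rewrite invr_gt0.
have qVy : (q k.+1)^-1 < 2 * y by rewrite -invf_plt ?posrE ?mulr_gt0.
pose z := ((q k.+1)^-1 + 2 * y) / 4.
have z0 : 0 < z by rewrite /z; lra.
have zy : z < y by rewrite /z; lra.
exists z; split=> //; apply: seq_floorE => //; apply/andP; split.
  by rewrite (le_trans ky)// lef_pV2 ?posrE ?mulr_gt0//; lra.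
by rewrite invf_plt ?posrE ?mulr_gt0// /z; lra.
Qed.

Lemma rearr_knot_step_le a k y : 0 < y -> q k <= (2 * y)^-1 < q k.+1 ->
  (rearr (fun x => f (x - a)) y <= (q k)%:E)%E.
Proof.
move=> y0 /(knot_step_near_left y0)[z [z0 zy <-]].
apply: rearr_shift_le => //.
- exact: knot_step_ge0.
- exact: knot_step_le0.
- exact: knot_step_ni.
Qed.

Lemma measurable_knot_step_shift a :
  measurable_fun (@nonneg R) (fun x => f (x - a)).
Proof.
apply: measurable_nonincreasing_on_pos_shift.
- exact: knot_step_le0.
- exact: knot_step_ni.
Qed.

Lemma phi_function_seq_infty : G (q j) @[j --> \oo] --> +oo.
Proof. by have [_ _ _ G_infty] := G_phi; exact: cvg_comp q_infty G_infty. Qed.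

Definition step_majorant x : \bar R :=
  (\sum_(0 <= j <oo) (G (q j))%:E * (\1_(`[0%R, (G (2 * q j))^-1]) x)%:E)%E.

Let step_majorant_term_ge0 j x :
  (0 <= (G (q j))%:E * (\1_(`[0%R, (G (2 * q j))^-1]) x)%:E)%E.
Proof.
by rewrite mule_ge0// lee_fin// phi_function_ge0// nondecreasing_seq_ge0.
Qed.

Lemma step_majorant_ge j x : 0 <= x -> x <= (G (2 * q j))^-1 ->
  ((G (q j))%:E <= step_majorant x)%E.
Proof.
move=> x0 xj; apply: le_trans (nneseries_ge_term j _); last first.
  by move=> i; exact: step_majorant_term_ge0.
by rewrite indicE mem_set/= ?mule1// in_itv/= x0.
Qed.

Lemma step_majorant0 : step_majorant 0 = +oo%E.
Proof.
apply/eqyP => A _; have [j _ Aj] := (cvgryPge _).1 phi_function_seq_infty A.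
apply: (@le_trans _ _ (G (q j))%:E); first by rewrite lee_fin Aj/=.
apply: step_majorant_ge => //; rewrite invr_ge0 phi_function_ge0//.
by rewrite mulr_ge0// nondecreasing_seq_ge0.
Qed.

(* For [x = (G s)^-1] with [2 * q k <= s < 2 * q k.+1], the rearrangement at
   [phi_inv (phi_tilde G) x = s^-1] is at most [q k]. *)
Lemma ext_phi_rearr_knot_step_le a x : 0 <= x ->
  (ext_phi G (rearr (fun z => f (z - a)) (phi_inv (phi_tilde G) x)) <=
   step_majorant x)%E.
Proof.
rewrite le_eqVlt => /predU1P[<-|x0]; first by rewrite step_majorant0 leey.
have q_ge0 := nondecreasing_seq_ge0 q0 q_nd.
have [s s0 Gs] : exists2 s, 0 < s & G s = x^-1.
  by apply: phi_function_surj => //; rewrite invr_gt0.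
have [k ks] : exists k, q k <= s / 2 < q k.+1.
  by apply: seq_bracket => //; rewrite divr_ge0// ltW.
apply: (@le_trans _ _ (G (q k))%:E).
  rewrite -[x]invrK -Gs phi_inv_tilde// -[leRHS]/(ext_phi G (q k)%:E).
  apply: ext_phi_le => //; first exact: rearr_ge0.
  by apply: rearr_knot_step_le; rewrite ?invr_gt0// invfM invrK mulrC.
have := q_ge0 k; rewrite le_eqVlt => /predU1P[qk0|qk_gt0].
  by rewrite -qk0 phi_function0//; exact: nneseries_ge0.
apply: step_majorant_ge; first exact: ltW.
rewrite -[leLHS]invrK -Gs lef_pV2 ?posrE ?(phi_function_gt0 G_phi) ?mulr_gt0//.
by rewrite phi_function_le ?mulr_ge0// ?(ltW s0)//; case/andP: ks; lra.
Qed.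

(* The term of index [0] is [0 / 0 = 0]. *)
Hypothesis sum_ratio_le1 :
  (\sum_(0 <= j <oo) (G (q j) / G (2 * q j))%:E <= 1)%E.

Lemma L1G_knot_step_shift a : L1G G (fun x => f (x - a)).
Proof.
have q_ge0 := nondecreasing_seq_ge0 q0 q_nd.
split; first exact: measurable_knot_step_shift.
apply: (@le_lt_trans _ _ 1%E); last exact: ltry.
apply: norm1G_le => //; apply: le_trans sum_ratio_le1.
rewrite [leRHS](_ : _ = (\sum_(0 <= j <oo)
    (G (q j))%:E * mu `[0%R, ((G (2 * q j))^-1)%R])%E).
  rewrite /modular1G invr1; apply: integral_le_nneseries.
  - exact: measurable_nonneg.
  - by move=> j; rewrite phi_function_ge0.
  - by move=> j; exact: measurable_itv.
  - by move=> j x /=; rewrite in_itv/= => /andP[].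
  - by move=> x x0; rewrite mule1; apply: ext_phi_ge0; [|exact: rearr_ge0].
  - by move=> x x0; rewrite mule1; exact: ext_phi_rearr_knot_step_le.
have Gq_ge0 j : 0 <= (G (2 * q j))^-1.
  by rewrite invr_ge0 phi_function_ge0// mulr_ge0.
apply: eq_eseriesr => j _; rewrite lebesgue_measure_itv/= lte_fin.
rewrite lt_neqAle Gq_ge0 andbT eq_sym.
by case: eqVneq => [->|_]; rewrite ?mulr0 ?mule0// oppr0 addr0 EFinM.
Qed.

Hypothesis G_double : \forall j \near \oo, 2 * G (q j) <= G (q j.+1).
Hypothesis G_dilate : forall c, 0 < c ->
  exists2 d, 0 < d & \forall j \near \oo, d * G (q j) <= G (q j / c).

Lemma ext_phi_rearr_add_ge c j x : 0 < c -> 1 <= q j -> 0 <= x ->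
  x <= (G (q j))^-1 ->
  ((G (q j / c))%:E <= ext_phi G
     (rearr (fun z => f z + f (z - 1))%R (phi_inv (phi_tilde G) x) *
      c^-1%:E))%E.
Proof.
move=> c0 qj1 x0 xj; have qj0 : 0 < q j by exact: lt_le_trans qj1.
rewrite -[leLHS]/(ext_phi G (q j / c)%:E); apply: ext_phi_le => //.
  by rewrite lee_fin divr_ge0// ltW.
rewrite EFinM lee_wpmul2r//; first by rewrite lee_fin invr_ge0 ltW.
apply: (@le_trans _ _ (f (2 * q j)^-1)%:E).
  by rewrite lee_fin; apply: seq_floor_ge; rewrite invfM invrK mulKf.
apply: rearr_add_shift_ge.
- exact: knot_step_ge0.
- exact: knot_step_le0.
- exact: knot_step_ni.
- by rewrite invr_gt0 mulr_gt0.
- by rewrite invf_le1 ?mulr_gt0//; lra.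
- by rewrite invfM mulrA mulfV// mul1r; exact: phi_inv_tilde_le.
Qed.

Lemma modular_knot_step_add_ge c N n : 0 < c ->
  (forall j, (N <= j)%N -> 1 <= q j) ->
  (\sum_(j < n) (G (q (N + j)%N / c) *
     ((G (q (N + j)%N))^-1 - (G (q (N + j).+1))^-1))%:E <=
   modular1G G (fun x => f x + f (x - 1))%R c)%E.
Proof.
move=> c0 qN; pose s j := q (N + j)%N.
have s_ge1 j : 1 <= s j by apply: qN; exact: leq_addr.
have s_gt0 j : 0 < s j by exact: lt_le_trans (s_ge1 j).
have Gs_gt0 j : 0 < G (s j) by exact: phi_function_gt0.
have Gs_ge0 j : 0 <= (G (s j))^-1 by rewrite invr_ge0 ltW.
have GsV_ni j : (G (s j.+1))^-1 <= (G (s j))^-1.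
  rewrite lef_pV2 ?posrE// phi_function_le ?(ltW (s_gt0 _))//.
  by rewrite /s addnS q_nd.
pose A j : set R := `](G (s j.+1))^-1, (G (s j))^-1]%classic.
rewrite [leLHS](_ : _ = (\sum_(j < n) (G (s j / c))%:E * mu (A j))%E).
  apply: (@sum_le_integral _ _ _ mu _ (@measurable_nonneg R)
    (fun j => G (s j / c)) A).
  - by move=> j; rewrite phi_function_ge0// divr_ge0// ltW.
  - by move=> j; exact: measurable_itv.
  - by move=> j x; rewrite /A/= in_itv/= => /andP[/ltW/(le_trans (Gs_ge0 _))].
  - exact: (@trivIset_itvoc _ (fun j => (G (s j))^-1)).
  - move=> x x0; apply: ext_phi_ge0 => //; apply: mule_ge0.
      exact: rearr_ge0.
    by rewrite lee_fin invr_ge0 ltW.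
  - move=> j x; rewrite /A/= in_itv/= => /andP[/ltW jx xj].
    apply: ext_phi_rearr_add_ge => //; first exact: s_ge1.
    exact: le_trans (Gs_ge0 _) jx.
apply: eq_bigr => j _; rewrite lebesgue_measure_itvoc// /s addnS.
exact: EFinM.
Qed.

Lemma modular_knot_step_add_gt1 c : 0 < c ->
  (1 < modular1G G (fun x => f x + f (x - 1))%R c)%E.
Proof.
move=> c0; have [d d0 dG] := G_dilate c0.
have [N _ qN] : \forall j \near \oo, [/\ 1 <= q j,
    d * G (q j) <= G (q j / c) & 2 * G (q j) <= G (q j.+1)].
  by near=> j; split; near: j => //; exact: (cvgryPge _).1.
have q_ge1 j : (N <= j)%N -> 1 <= q j by move=> /qN[].
pose n := (Num.truncn (d / 2)^-1).+1.
apply: lt_le_trans (modular_knot_step_add_ge n c0 q_ge1).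
apply: (@lt_le_trans _ _ (\sum_(j < n) (d / 2)%:E)%E).
  rewrite sumEFin sumr_const card_ord lte_fin -[ltRHS]mulr_natl.
  by rewrite -ltr_pdivrMr ?divr_gt0// mul1r truncnS_gt.
apply: lee_sum => j _; have := qN _ (leq_addr j N).
set u := G (q (N + j)%N) => -[/(lt_le_trans ltr01) q_gt0 du uv].
rewrite lee_fin; have u0 : 0 < u by exact: phi_function_gt0.
have half_gap : 2^-1 * u^-1 <= u^-1 - (G (q (N + j).+1))^-1.
  have : (G (q (N + j).+1))^-1 <= (2 * u)^-1.
    by rewrite lef_pV2 ?posrE ?mulr_gt0// (lt_le_trans _ uv)// mulr_gt0.
  by rewrite invfM; lra.
have -> : d / 2 = d * u * (2^-1 * u^-1) by field; rewrite gt_eqF.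
by apply: ler_pM => //; rewrite mulr_ge0 ?invr_ge0 ?(ltW d0) ?(ltW u0).
Unshelve. all: by end_near. Qed.

Lemma not_L1G_knot_step_add : ~ L1G G (fun x => f x + f (x - 1)).
Proof.
by move=> [_]; rewrite norm1G_infty ?ltxx//; exact: modular_knot_step_add_gt1.
Qed.

Lemma L1G_not_addr_closed :
  ~ (forall f g, L1G G f -> L1G G g -> L1G G (fun x => f x + g x)).
Proof.
move=> addG; apply: not_L1G_knot_step_add; apply: addG.
  by have := L1G_knot_step_shift 0; under eq_fun do rewrite subr0.
exact: L1G_knot_step_shift.
Qed.

End AdditivityCriterion.

Section AffineEnvelope.
Variables (R : realType) (s q : nat -> R).
Hypothesis s_gt0 : 0 < s 0%N.
Hypothesis s_nd : {homo s : i j / (i <= j)%N >-> i <= j}.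
Hypothesis q0 : q 0%N = 0.
Hypothesis q_nd : {homo q : i j / (i <= j)%N >-> i <= j}.
Hypothesis q_infty : q j @[j --> \oo] --> +oo.
Implicit Types (j k n : nat) (c t u : R).

Definition affine_envelope t : R := sup (range (fun j => s j * (t - q j))).

Local Notation G := affine_envelope.

Let slope_gt0 j : 0 < s j.
Proof. by rewrite (lt_le_trans s_gt0)// s_nd. Qed.

Lemma affine_tail_le n k t : t <= q n.+1 -> (n <= k)%N ->
  s k * (t - q k) <= s n * (t - q n).
Proof.
move=> tn; rewrite leq_eqVlt => /predU1P[<-//|nk].
apply: (@le_trans _ _ (s n * (t - q k))).
  by rewrite ler_wnM2r ?s_nd ?(ltnW nk)// subr_le0 (le_trans tn) ?q_nd.
by rewrite ler_pM2l// lerB ?q_nd ?(ltnW nk).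
Qed.

Lemma affine_envelope_le n t b : t <= q n.+1 ->
  (forall j, (j <= n)%N -> s j * (t - q j) <= b) -> G t <= b.
Proof.
move=> tn bP; apply: ge_sup; first by exists (s 0%N * (t - q 0%N)), 0%N.
move=> _ [j _ <-]; have [|/ltnW nj] := leqP j n; first exact: bP.
by apply: le_trans (affine_tail_le tn nj) _; exact: bP.
Qed.

Lemma seq_unbounded t : exists n, t <= q n.+1.
Proof.
have [n _ tn] := (cvgryPge _).1 q_infty t.
by exists n; apply: tn => /=.
Qed.

Lemma affine_envelope_ge j t : s j * (t - q j) <= G t.
Proof.
apply: ub_le_sup; last by exists j.
have [n tn] := seq_unbounded t; exists (s n * `|t|) => _ [k _ <-].
have le_n i : (i <= n)%N -> s i * (t - q i) <= s n * `|t|.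
  move=> i_le.
  apply: (@le_trans _ _ (s i * `|t|)); last by rewrite ler_wpM2r// s_nd.
  rewrite ler_pM2l// lerBlDr (le_trans (ler_norm t))// lerDl.
  exact: nondecreasing_seq_ge0.
have [|/ltnW nk] := leqP k n; first exact: le_n.
by apply: le_trans (affine_tail_le tn nk) _; exact: le_n.
Qed.

Lemma affine_envelope0 : G 0 = 0.
Proof.
apply/le_anti/andP; split.
  apply: (@affine_envelope_le 0); first exact: nondecreasing_seq_ge0.
  by move=> j; rewrite leqn0 => /eqP->; rewrite q0 subrr mulr0.
by have := affine_envelope_ge 0 0; rewrite q0 subrr mulr0.
Qed.

Lemma affine_envelope_ge_linear t : s 0%N * t <= G t.
Proof. by have := affine_envelope_ge 0 t; rewrite q0 subr0. Qed.

Lemma affine_envelope_le_linear n t : 0 <= t -> t <= q n.+1 -> G t <= s n * t.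
Proof.
move=> t0 tn; apply: (affine_envelope_le tn) => j jn.
apply: (@le_trans _ _ (s j * t)); last by rewrite ler_wpM2r// s_nd.
by rewrite ler_pM2l// gerBl nondecreasing_seq_ge0.
Qed.

Lemma affine_envelope_lt t u : t < u -> G t < G u.
Proof.
move=> tu; apply: (@lt_le_trans _ _ (G t + s 0%N * (u - t))).
  by rewrite ltrDl mulr_gt0// subr_gt0.
have [n tn] := seq_unbounded t; rewrite -lerBrDr.
apply: (affine_envelope_le tn) => j _; rewrite lerBrDr.
apply: le_trans (affine_envelope_ge j u).
have -> : s j * (u - q j) = s j * (t - q j) + s j * (u - t) by ring.
by rewrite lerD2l ler_wpM2r ?s_nd// subr_ge0 ltW.
Qed.

Lemma affine_envelope_lipschitz n t u : t <= q n.+1 -> u <= q n.+1 ->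
  `|G t - G u| <= s n * `|t - u|.
Proof.
move=> tn un.
have half v w : v <= q n.+1 -> G v - G w <= s n * `|v - w|.
  move=> vn; rewrite lerBlDr; apply: (affine_envelope_le vn) => j jn.
  have -> : s j * (v - q j) = s j * (v - w) + s j * (w - q j) by ring.
  rewrite lerD ?affine_envelope_ge//.
  apply: (@le_trans _ _ (s j * `|v - w|)); last by rewrite ler_wpM2r// s_nd.
  by rewrite ler_pM2l// ler_norm.
by rewrite ler_norml half// andbT lerNl opprB distrC half.
Qed.

Lemma affine_envelope_continuous : continuous G.
Proof.
move=> t; have [n tn] := seq_unbounded (t + 1).
apply/cvgrPdist_le => e e0; near=> u.
apply: le_trans (affine_envelope_lipschitz _ _) _; last first.
- rewrite mulrC -ler_pdivlMr//; near: u.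
  by apply: cvgr_dist_le => //; rewrite divr_gt0.
- by apply: le_trans tn; apply: ltW; near: u; apply: lt_nbhsl; rewrite ltrDl.
- by rewrite (le_trans _ tn)// lerDl.
Unshelve. all: by end_near. Qed.

Lemma affine_envelope_phi_function : phi_function G.
Proof.
split.
- exact/continuous_subspaceT/affine_envelope_continuous.
- by move=> x y _; exact: affine_envelope_lt.
- exact: affine_envelope0.
- apply/cvgryPge => A; near=> t.
  apply: le_trans (affine_envelope_ge_linear t).
  by rewrite mulrC -ler_pdivrMr//; near: t.
Unshelve. all: by end_near. Qed.

Lemma affine_envelope_superhomogeneous c t : 1 <= c -> c * G t <= G (c * t).
Proof.
move=> c1; have c0 : 0 < c by exact: lt_le_trans c1.
have [n tn] := seq_unbounded t; rewrite mulrC -ler_pdivlMr//.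
apply: (affine_envelope_le tn) => j _; rewrite ler_pdivlMr//.
apply: le_trans (affine_envelope_ge j (c * t)).
rewrite -mulrA ler_pM2l// mulrBl [t * c]mulrC lerD2l lerN2.
by rewrite ler_peMr// nondecreasing_seq_ge0.
Qed.

Lemma affine_envelope_dilatory : dilatory G.
Proof.
exists 2, 2; split=> [||t _]; rewrite ?ltr1n//.
by rewrite affine_envelope_superhomogeneous ?ler1n.
Qed.

Lemma affine_envelope_jump j : 0 < q j.+1 ->
  G (q j.+1) / G (2 * q j.+1) <= s j / s j.+1.
Proof.
move=> qj0; rewrite ler_pdivrMr; last first.
  by rewrite phi_function_gt0 ?mulr_gt0//; exact: affine_envelope_phi_function.
rewrite mulrAC ler_pdivlMr//.
apply: (@le_trans _ _ (s j * q j.+1 * s j.+1)).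
  by rewrite ler_pM2r// affine_envelope_le_linear// ltW.
rewrite -mulrA ler_pM2l// mulrC.
by apply: le_trans (affine_envelope_ge j.+1 _); rewrite ler_pM2l//; lra.
Qed.

Lemma affine_envelope_dilate j c : 0 < c -> 2 * c * q j <= q j.+1 ->
  (2 * c)^-1 * G (q j.+1) <= G (q j.+1 / c).
Proof.
move=> c0 cq; apply: le_trans (affine_envelope_ge j _).
have qc : q j <= q j.+1 / (2 * c) by rewrite ler_pdivlMr ?mulr_gt0// mulrC.
have qc2 : q j.+1 / c = 2 * (q j.+1 / (2 * c)) by field; rewrite gt_eqF.
apply: (@le_trans _ _ (s j * (q j.+1 / (2 * c)))); last first.
  by rewrite ler_pM2l// qc2; lra.
rewrite mulrA mulrC ler_pM2r ?invr_gt0 ?mulr_gt0//.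
by rewrite affine_envelope_le_linear// nondecreasing_seq_ge0.
Qed.

Hypothesis s_growth : forall j, 2 ^+ j.+2 * s j <= s j.+1.
Hypothesis q_growth : forall c, \forall j \near \oo, c * q j <= q j.+1.

Lemma affine_envelope_sum_jump :
  (\sum_(0 <= j <oo) (G (q j) / G (2 * q j))%:E <= 1)%E.
Proof.
have G_phi := affine_envelope_phi_function.
have q_ge0 := nondecreasing_seq_ge0 q0 q_nd.
apply: (@le_trans _ _ (\sum_(0 <= j <oo) (1 / (2 ^ (j + 1))%:R)%:E)%E).
  apply: lee_nneseries => [j _ _|j _].
    by rewrite lee_fin divr_ge0// phi_function_ge0// mulr_ge0.
  rewrite lee_fin; case: j => [|j]; first by rewrite q0 affine_envelope0 mul0r.
  have := q_ge0 j.+1; rewrite le_eqVlt => /predU1P[<-|/affine_envelope_jump].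
    by rewrite affine_envelope0 mul0r.
  move=> /le_trans; apply.
  by rewrite ler_pdivrMr// div1r addn1 natrX ler_pdivlMl ?exprn_gt0.
have := @cvg_geometric_eseries_half R 1 0.
by move=> /cvg_lim; rewrite /eseries/= => ->//; rewrite expr0 divr1.
Qed.

Lemma affine_envelope_not_addr_closed :
  ~ (forall f g, L1G G f -> L1G G g -> L1G G (fun x => f x + g x)).
Proof.
apply: (L1G_not_addr_closed affine_envelope_phi_function q0) => //.
- exact: affine_envelope_sum_jump.
- near=> j; apply: le_trans (affine_envelope_superhomogeneous _ _) _.
    by rewrite ler1n.
  have : 2 * q j <= q j.+1 by near: j; exact: q_growth.
  by rewrite le_eqVlt => /predU1P[->//|/affine_envelope_lt/ltW].
move=> c c0; exists (2 * c)^-1; first by rewrite invr_gt0 mulr_gt0.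
have [N _ qN] := q_growth (2 * c); exists N.+1 => // -[//|j] Nj.
by apply: affine_envelope_dilate => //; exact: qN.
Unshelve. all: by end_near. Qed.

End AffineEnvelope.

Section FactorialKnots.
Variable R : realType.
Implicit Types (i j : nat) (c : R).

Definition slope j : R := 2 ^+ (j * j.+1).

Definition knot j : R := (j * j`!)%:R.

Lemma slope_growth j : 2 ^+ j.+2 * slope j <= slope j.+1.
Proof. by rewrite /slope -exprD ler_eXn2l ?ltr1n//; lia. Qed.

Lemma slope_nd : {homo slope : i j / (i <= j)%N >-> i <= j}.
Proof. by move=> i j ij; rewrite /slope ler_eXn2l ?ltr1n// leq_mul. Qed.

Lemma knot_growth j : j.+1%:R * knot j <= knot j.+1.
Proof. by rewrite /knot -natrM ler_nat factS !leq_mul. Qed.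

Lemma knot_nd : {homo knot : i j / (i <= j)%N >-> i <= j}.
Proof. by move=> i j ij; rewrite /knot ler_nat leq_mul// leq_fact. Qed.

Lemma knot_infty : knot j @[j --> \oo] --> +oo.
Proof.
apply/cvgryPge => A; near=> j; rewrite (@le_trans _ _ j%:R)//.
  near: j; exact: nbhs_infty_ger.
by rewrite /knot ler_nat leq_pmulr// fact_gt0.
Unshelve. all: by end_near. Qed.

Lemma knot_growth_infty c : \forall j \near \oo, c * knot j <= knot j.+1.
Proof.
near=> j; apply: le_trans (knot_growth j).
rewrite ler_wpM2r// (@le_trans _ _ j%:R) ?ler_nat//.
near: j; exact: nbhs_infty_ger.
Unshelve. all: by end_near. Qed.

End FactorialKnots.

Theorem theorem4p2 (R : realType) :
  exists G : R -> R,
    [/\ phi_function G, dilatory G & ~ quasi_Banach_L1G G].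
Proof.
have slope_gt0 : 0 < slope R 0 by [].
have knot0 : knot R 0 = 0 by [].
have s_nd := @slope_nd R; have q_nd := @knot_nd R.
have q_infty := @knot_infty R.
exists (affine_envelope (@slope R) (@knot R)); split.
- exact: affine_envelope_phi_function.
- exact: affine_envelope_dilatory.
move=> [[addG _] _ _ _ _].
apply: (affine_envelope_not_addr_closed slope_gt0 s_nd knot0 q_nd) addG => //.
- exact: slope_growth.
- exact: knot_growth_infty.
Qed.
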